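(* For a real Banach space $X$, consider the following statements: (a) $X^*$ is the closed linear span of the w*-weak points of continuity of $B(X^* )$. (b) Any two distinct points in $X^{**}$ are separated by disjoint closed balls of $X^{**}$ having centres in $X$; that is, for all $x^{**}\neq y^{**}$ in $X^{**}$ there are disjoint closed balls $B_1,B_2$ of $X^{**}$ with centres in $X$ such that $x^{**}\in B_1$ and $y^{**}\in B_2$. (c) $X$ is nicely smooth. (d) For every norm dense set $A\subseteq S(X)$ and every support mapping $\phi$, the set $\phi(A)$ separates points of $X^{**}$. Then $(a)\Rightarrow(b)\Rightarrow(c)\Rightarrow(d)$.
   Context: All Banach spaces are real. $B(X)$ and $S(X)$ denote the closed unit ball and unit sphere of $X$; $X$ is identified with its canonical image in $X^{**}$. A set $A\subseteq B(X^* )$ is a norming set for $X$ if $\|x\|=\sup\{x^*(x):x^*\in A\}$ for all $x\in X$. A closed subspace $F\subseteq X^*$ is a norming subspace if $B(F)$ is a norming set for $X$. $X$ is nicely smooth if $X^*$ contains no proper norming (closed) subspace. A point $f\in B(X^* )$ is a w*-weak PC (point of continuity) of $B(X^* )$ if the identity map $(B(X^* ),w^* )\to(B(X^* ),\text{weak})$ is continuous at $f$. For $x\in S(X)$ let $D(x)=\{f\in S(X^* ):f(x)=1\}$; a support mapping is any map $\phi:S(X)\to S(X^* )$ with $\phi(x)\in D(x)$ for all $x\in S(X)$. *)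

(* Defs.v *)
From HB Require Import structures.
From mathcomp Require Import all_boot all_order all_algebra.
From mathcomp Require Import all_classical all_reals all_analysis.

Set Implicit Arguments.
Unset Strict Implicit.
Unset Printing Implicit Defensive.

Import Order.TTheory GRing.Theory Num.Theory.
Import numFieldNormedType.Exports.

Local Open Scope classical_set_scope.
Local Open Scope ring_scope.

Section BallsAndSpheres.
Context {R : realType} (E : normedModType R).

Definition unit_ball : set E := [set x | `|x| <= 1].

Definition unit_sphere : set E := [set x | `|x| = 1].

End BallsAndSpheres.
Arguments unit_ball {R} E.
Arguments unit_sphere {R} E.

Section Dual.
Context {R : realType} (E : normedModType R).

Definition lin_cont : {pred (E -> R^o)} :=
  [pred f : E -> R^o | `[< linear f /\ continuous f >] ].

Lemma lin_contP (f : E -> R^o) :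
  reflect (linear f /\ continuous f) (f \in lin_cont).
Proof. exact: asboolP. Qed.

Lemma lin_cont_submod_closed : GRing.submod_closed lin_cont.
Proof.
split.
  apply/lin_contP; split; last exact: cst_continuous.
  by move=> a x y; rewrite scaler0 addr0.
move=> a f g /lin_contP[lf cf] /lin_contP[lg cg]; apply/lin_contP; split.
  move=> b x y; rewrite /GRing.add /= /GRing.scale /=.
  rewrite lf lg /GRing.scale /=.
  by rewrite !mulrDr addrACA; congr (_ + _); rewrite mulrCA.
move=> x; apply: cvgD (cg x).
exact: cvgZl_tmp (cf x).
Qed.

HB.instance Definition _ :=
  GRing.isSubmodClosed.Build R (E -> R^o) lin_cont lin_cont_submod_closed.

Record dual := Dual {
  dual_fun :> E -> R^o ;
  dual_fun_lin_cont : dual_fun \in lin_cont }.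

HB.instance Definition _ := [isSub for dual_fun].
HB.instance Definition _ := [Choice of dual by <:].
HB.instance Definition _ := [SubChoice_isSubLmodule of dual by <:].

Implicit Types f g : dual.

Lemma dual_linear f : linear f.
Proof. by have /lin_contP[] := dual_fun_lin_cont f. Qed.

Lemma dual_continuous f : continuous f.
Proof. by have /lin_contP[] := dual_fun_lin_cont f. Qed.

HB.instance Definition _ f :=
  GRing.isLinear.Build R E R^o *:%R (dual_fun f) (@dual_linear f).

Definition dual_norm f : R := sup [set `|f x| | x in unit_ball E].

Lemma dual_norm_has_sup f : has_sup [set `|f x| | x in unit_ball E].
Proof.
split; first by exists `|f 0|, 0 => //; rewrite /unit_ball/= normr0 ler01.
have /linear_bounded_continuous := @dual_continuous f.
move=> /bounded_funP /(_ 1)[M fM].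
by exists M => _ [x x1 <-]; exact: fM.
Qed.

Lemma ler_dual_norm f x : `|f x| <= dual_norm f * `|x|.
Proof.
have [->|x0] := eqVneq x 0; first by rewrite linear0 !normr0 mulr0.
have nx : 0 < `|x| by rewrite normr_gt0.
rewrite -ler_pdivrMr//.
have -> : `|f x| / `|x| = `|f (`|x|^-1 *: x)|.
  by rewrite linearZ/= normrM ger0_norm ?invr_ge0// mulrC.
apply: ub_le_sup; first by have [] := dual_norm_has_sup f.
by exists (`|x|^-1 *: x) => //; rewrite /unit_ball/= normfZV.
Qed.

Lemma dual_norm_le f (c : R) : 0 <= c ->
  (forall x, `|f x| <= c * `|x|) -> dual_norm f <= c.
Proof.
move=> c0 fc; apply: ge_sup; first by have [] := dual_norm_has_sup f.
move=> _ [x x1 <-]; apply: (le_trans (fc x)).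
by rewrite -[leRHS]mulr1 ler_wpM2l.
Qed.

Lemma dual_norm_ge0 f : 0 <= dual_norm f.
Proof.
apply: le_trans (normr_ge0 (f 0)) _.
apply: ub_le_sup; first by have [] := dual_norm_has_sup f.
by exists 0 => //; rewrite /unit_ball/= normr0 ler01.
Qed.

Lemma dual_normD f g : dual_norm (f + g) <= dual_norm f + dual_norm g.
Proof.
apply: dual_norm_le; first by rewrite addr_ge0 ?dual_norm_ge0.
move=> x; rewrite mulrDl.
by apply: (le_trans (ler_normD (f x) (g x))); rewrite lerD ?ler_dual_norm.
Qed.

Lemma dual_normZ (a : R) f : dual_norm (a *: f) = `|a| * dual_norm f.
Proof.
have le b h : dual_norm (b *: h) <= `|b| * dual_norm h.
  apply: dual_norm_le; first by rewrite mulr_ge0 ?dual_norm_ge0.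
  move=> x; rewrite -mulrA.
  have -> : (b *: h) x = b * h x by [].
  by rewrite normrM ler_wpM2l// ler_dual_norm.
apply/eqP; rewrite eq_le le/=.
have [->|a0] := eqVneq a 0; first by rewrite normr0 mul0r dual_norm_ge0.
rewrite -ler_pdivlMl ?normr_gt0//.
by have := le a^-1 (a *: f); rewrite scalerA mulVf// scale1r normfV.
Qed.

Lemma dual_norm0_eq0 f : dual_norm f = 0 -> f = 0.
Proof.
move=> f0; apply/val_inj/funext => x /=.
by apply/eqP; rewrite -normr_le0 -(mul0r `|x|) -f0 ler_dual_norm.
Qed.

HB.instance Definition _ :=
  Lmodule_isNormed.Build R dual dual_normD dual_normZ dual_norm0_eq0.

End Dual.

Section Canonical.
Context {R : realType} (E : normedModType R).

Lemma eval_lin_cont (x : E) :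
  (fun f : dual E => f x : R^o) \in @lin_cont R (dual E).
Proof.
apply/lin_contP.
have ml : linear (fun f : dual E => f x : R^o) by [].
split=> //.
pose e : {linear dual E -> R^o} := HB.pack (fun f : dual E => f x : R^o)
  (GRing.isLinear.Build R (dual E) R^o *:%R (fun f : dual E => f x : R^o) ml).
apply: (@bounded_linear_continuous R (dual E) R^o e).
apply/bounded_funP => r; exists (r * `|x|) => f fr.
by apply: (le_trans (ler_dual_norm f x)); exact: ler_wpM2r.
Qed.

Definition canonical_image (x : E) : dual (dual E) := Dual (eval_lin_cont x).

Definition weak_star : Type :=
  initial_topology (fun f : dual E => (f : E -> R^o) : {ptws E -> R^o}).

HB.instance Definition _ := Topological.on weak_star.

Definition weak : Type :=
  initial_topology (fun x : E => (fun f : dual E => f x) : {ptws dual E -> R^o}).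

HB.instance Definition _ := Topological.on weak.

End Canonical.
Arguments weak_star {R} E.
Arguments weak {R} E.

Definition closed_linear_span {R : realType} {E : normedModType R}
    (A : set E) : set E :=
  closure (smallest (fun F : set E => GRing.submod_closed [in F]) A).

Section NicelySmooth.
Context {R : realType} (X : normedModType R).

(* The supremum is taken in [\bar R], where it exists for every set. *)
Definition norming_set (A : set (dual X)) : Prop :=
  A `<=` unit_ball (dual X) /\
  forall x : X, (`|x|)%:E = ereal_sup [set (f x)%:E | f in A].

Definition norming_subspace (F : set (dual X)) : Prop :=
  [/\ closed F, GRing.submod_closed [in F] &
      norming_set (F `&` unit_ball (dual X))].

Definition nicely_smooth : Prop :=
  forall F : set (dual X), norming_subspace F -> F = [set: dual X].

(* [dual X], [weak_star X] and [weak (dual X)] are the same type with the norm,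
   w* and weak topologies; [subspace] restricts the last two to the ball. *)
Definition wstar_weak_PC (f : dual X) : Prop :=
  unit_ball (dual X) f /\
  {for f, continuous
    ((fun g => g) : subspace (unit_ball (dual X) : set (weak_star X)) ->
                    subspace (unit_ball (dual X) : set (weak (dual X))))}.

Definition duality_set (x : X) : set (dual X) :=
  [set f | unit_sphere (dual X) f /\ f x = 1].

(* Only the values on the unit sphere are constrained or used. *)
Definition support_mapping (phi : X -> dual X) : Prop :=
  forall x : X, unit_sphere X x -> duality_set x (phi x).

Definition separates_bidual (A : set (dual X)) : Prop :=
  forall u v : dual (dual X), u <> v -> exists2 f, A f & u f <> v f.

End NicelySmooth.

(* Main.v *)
From HB Require Import structures.
Require Import Defs.
From mathcomp Require Import all_boot all_order all_algebra.
From mathcomp Require Import all_classical all_reals all_analysis.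
From mathcomp Require Import ring lra.

Set Implicit Arguments.
Unset Strict Implicit.
Unset Printing Implicit Defensive.

Import Order.TTheory GRing.Theory Num.Theory.
Import numFieldNormedType.Exports.

Local Open Scope classical_set_scope.
Local Open Scope ring_scope.

(** Write D for the dual of X, B for its unit ball, and regard X as a subspace
of its bidual.

From points of continuity to balls. Let f be a w*-weak point of continuity of
B and u an element of the bidual. Then u(f) is the infimum of f(x) + |x - u|
over x in X ([wstar_weak_PC_ball_approx]). Indeed, continuity at f says that
u(g) < u(f) + d for those g in B that satisfy finitely many constraints
g(x_i) < f(x_i) + 1. These constraints hold strictly at f, so Lagrange
multipliers exist ([linear_multiplier]): some combination y of the x_i
satisfies u(g) - u(f) - d <= g(y) - f(y) on all of B, that is,
f(y) + |y - u| <= u(f) + d. Every w in the ball of centre y and radius r has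
w(f) <= f(y) + r, so for each c > u(f) there is a ball centred in X which
contains u and lies in the half-space where w(f) < c. If u(f) < v(f), this
applied to u and to - v, with c midway between u(f) and v(f), gives disjoint
balls. Some point of continuity f has u(f) different from v(f) whenever u and
v differ, because these points span a dense subspace of D.

From balls to nice smoothness. If a closed subspace F of D is proper,
Hahn-Banach provides u different from 0 in the bidual that vanishes on F
([annihilator_neq0]). If F is norming as well, then |x| <= |x - u| for all x
in X, because x and x - u agree on F. Hence every ball centred in X that
contains u also contains 0, so that no two disjoint balls centred in X separate
u from 0.

From nice smoothness to support mappings. An element a of A close to x / |x|
satisfies phi(a)(x / |x|) >= 1 - |x / |x| - a|, so the closed span of phi(A)
is norming ([support_mapping_norming]); nice smoothness makes it all of D, and
two elements of the bidual which agree on phi(A) then agree on D. *)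

(** * Sublinear functionals and the Hahn-Banach theorem *)

Section Sublinear.
Context {R : realType} {E : lmodType R}.
Implicit Types (p q : E -> R) (x y z : E) (t : R).

Definition sublinear q : Prop :=
  (forall x y, q (x + y) <= q x + q y) /\
  (forall t x, 0 <= t -> q (t *: x) <= t * q x).

Lemma sublinear0 q : sublinear q -> q 0 = 0.
Proof.
move=> [qD qZ]; apply/eqP; rewrite eq_le; apply/andP; split.
  by have := qZ 0 0 (lexx 0); rewrite scale0r mul0r.
by have := qD 0 0; rewrite addr0; lra.
Qed.

Lemma sublinearZ q t x : sublinear q -> 0 <= t -> q (t *: x) = t * q x.
Proof.
move=> sq t0; apply/eqP; rewrite eq_le; apply/andP; split; first exact: sq.2.
have [->|tn0] := eqVneq t 0; first by rewrite mul0r scale0r sublinear0.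
have tgt0 : 0 < t by rewrite lt_neqAle eq_sym tn0.
have := sq.2 t^-1 (t *: x); rewrite invr_ge0 scalerA mulVf// scale1r => /(_ t0).
by rewrite mulrC ler_pdivlMr// mulrC.
Qed.

Lemma sublinear_geN q x : sublinear q -> - q (- x) <= q x.
Proof.
by move=> sq; have := sq.1 x (- x); rewrite subrr (sublinear0 sq); lra.
Qed.

(** The distance to a subspace, the infimum of a chain, and [straighten] below
are infima of families whose members need not be sublinear one by one: each
inequality only has to hold with some member of the family on its left. *)
Lemma sublinear_inf (I : Type) (D : set I) (q : I -> E -> R) :
    D !=set0 -> (forall x, has_lbound [set q i x | i in D]) ->
    (forall i j, D i -> D j -> forall x y,
      exists2 k, D k & q k (x + y) <= q i x + q j y) ->
    (forall i t, D i -> 0 <= t -> forall x,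
      exists2 k, D k & q k (t *: x) <= t * q i x) ->
  sublinear (fun x => inf [set q i x | i in D]).
Proof.
move=> [i0 Di0] lbq qD qZ.
have inf_le i x : D i -> inf [set q i x | i in D] <= q i x.
  by move=> Di; apply: ge_inf; [exact: lbq|exists i].
have inf_ex x e : 0 < e ->
    exists2 i, D i & q i x < inf [set q i x | i in D] + e.
  move=> e0; have [|_ [i Di <-] qi] := @inf_adherent _ _ e e0 (conj _ (lbq x)).
    by exists (q i0 x), i0.
  by exists i.
split=> [x y|t x t0]; apply/ler_addgt0Pr => e e0.
  have [|i Di qi] := inf_ex x (e / 2); first by rewrite divr_gt0.
  have [|j Dj qj] := inf_ex y (e / 2); first by rewrite divr_gt0.
  have [k Dk qk] := qD i j Di Dj x y.
  by have := inf_le k (x + y) Dk; lra.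
(* Dividing by t + 1 rather than t covers t = 0. *)
have t1 : 0 < t + 1 by lra.
have [|i Di qi] := inf_ex x (e / (t + 1)); first by rewrite divr_gt0.
have [k Dk qk] := qZ i t Di t0 x.
apply: le_trans (inf_le k _ Dk) (le_trans qk _).
apply: le_trans (ler_wpM2l t0 (ltW qi)) _; rewrite mulrDr lerD2l.
by rewrite mulrCA ger_pMr// ler_pdivrMr// mul1r; lra.
Qed.

(** This is the largest sublinear minorant of [q] that agrees with [q] at [z] and
is linear on the line through [z]. It is the only tool needed to pass from sublinear to linear: a
minimal [q] equals all its [straighten q z], and its value at [- z] can be
prescribed. *)
Definition straighten q z x : R :=
  inf [set q (x + t *: z) - t * q z | t in [set t | 0 <= t]].

Lemma straighten_has_lbound q z x : sublinear q ->
  has_lbound [set q (x + t *: z) - t * q z | t in [set t | 0 <= t]].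
Proof.
move=> sq; exists (- q (- x)) => _ [t /= t0 <-].
have := sq.1 (x + t *: z) (- x).
by rewrite addrAC subrr add0r sublinearZ//; lra.
Qed.

Lemma sublinear_straighten q z : sublinear q -> sublinear (straighten q z).
Proof.
move=> sq; apply: sublinear_inf => [|x|s t s0 t0 x y|t s t0 s0 x].
- by exists 0 => /=.
- exact: straighten_has_lbound.
- exists (s + t); first exact: addr_ge0.
  have := sq.1 (x + s *: z) (y + t *: z).
  by rewrite scalerDl addrACA mulrDl; lra.
- exists (s * t); first exact: mulr_ge0.
  by rewrite -scalerA -scalerDr sublinearZ// mulrBr mulrA.
Qed.

Lemma straighten_le q z x : sublinear q -> straighten q z x <= q x.
Proof.
move=> sq; apply: ge_inf; first exact: straighten_has_lbound.
by exists 0 => //=; rewrite scale0r addr0 mul0r subr0.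
Qed.

Lemma straighten_opp q z : sublinear q -> straighten q z (- z) <= - q z.
Proof.
move=> sq; apply: ge_inf; first exact: straighten_has_lbound.
by exists 1 => //=; rewrite scale1r addNr sublinear0// mul1r sub0r.
Qed.

(** Zorn's lemma for the reverse pointwise order: a chain has its pointwise
infimum as a bound, which is finite since q(x) >= - q(- x) >= - p(- x). *)
Lemma minimal_sublinear p : sublinear p ->
  exists q, [/\ sublinear q, forall x, q x <= p x &
    forall q', sublinear q' -> (forall x, q' x <= q x) -> q' = q].
Proof.
move=> sp; pose T := {q | sublinear q /\ forall x, q x <= p x}.
pose below (s t : T) := `[< forall x, sval t x <= sval s x >].
have [|r s t /asboolP rs /asboolP st|||m minm] := @Zorn T below.
- by move=> t; apply/asboolP.
- by apply/asboolP => x; exact: le_trans (st x) (rs x).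
- move=> [s Hs] [t Ht] /asboolP/= st /asboolP/= ts.
  have eq_st : s = t by apply/funext => x; apply/le_anti; rewrite st ts.
  by subst t; congr exist; exact: Prop_irrelevance.
- move=> C totC.
  have [[c Cc]|C0] := pselect (C !=set0); last first.
    by exists (exist _ p (conj sp (fun=> lexx _))) => s Cs; case: C0; exists s.
  have lbC x : has_lbound [set sval s x | s in C].
    exists (- p (- x)) => _ [s Cs <-].
    have [ss sle] := svalP s.
    by have := sublinear_geN x ss; have := sle (- x); lra.
  have sinf : sublinear (fun x => inf [set sval s x | s in C]).
    apply: sublinear_inf => //; first by exists c.
      move=> s t Cs Ct x y; have [ss _] := svalP s; have [ts _] := svalP t.
      have [/asboolP st|/asboolP st] := totC s t Cs Ct.
        by exists t => //; have := ts.1 x y; have := st x; lra.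
      by exists s => //; have := ss.1 x y; have := st y; lra.
    by move=> s t Cs t0 x; exists s => //; exact: (svalP s).1.2.
  have infle s x : C s -> inf [set sval s x | s in C] <= sval s x.
    by move=> Cs; apply: ge_inf => //; exists s.
  have infp x : inf [set sval s x | s in C] <= p x.
    exact: le_trans (infle c x Cc) ((svalP c).2 x).
  pose m : T := exist _ (fun x => inf [set sval s x | s in C]) (conj sinf infp).
  by exists m => s Cs; apply/asboolP => x; exact: infle.
- exists (sval m); have [sm mp] := svalP m; split=> [//|//|q' sq' q'm].
  have q'p x : q' x <= p x := le_trans (q'm x) (mp x).
  by rewrite -(minm (exist _ q' (conj sq' q'p)))//; exact/asboolP.
Qed.

(** Take a minimal sublinear u below [straighten p z]. Minimality forces
u = straighten u x for each x, whence u(- x) <= - u(x): so u is odd, and an odd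
sublinear functional is linear. At [- z] the bound is - p(z), which turns into
u(z) >= p(z). *)
Lemma hahn_banach p z : sublinear p ->
  exists u : E -> R, [/\ linear (u : E -> R^o), forall x, u x <= p x &
    u z = p z].
Proof.
move=> sp.
have [u [su up minu]] := minimal_sublinear (sublinear_straighten z sp).
have uN x : u (- x) = - u x.
  apply/le_anti/andP; split; last by rewrite lerNl; have := sublinear_geN x su.
  have <- : straighten u x = u.
    by apply: minu; [exact: sublinear_straighten|move=> y; exact: straighten_le].
  suff -> : straighten u x x = u x by exact: straighten_opp.
  congr (_ x); apply: minu; first exact: sublinear_straighten.
  by move=> y; exact: straighten_le.
have uD x y : u (x + y) = u x + u y.
  apply/le_anti; rewrite su.1/=.
  by have := su.1 (- x) (- y); rewrite -opprD !uN; lra.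
exists u; split.
- move=> a x y /=; rewrite uD; congr (_ + _).
  have [a0|a0] := leP 0 a; first exact: sublinearZ.
  rewrite -[a]opprK scaleNr uN sublinearZ ?oppr_ge0 ?ltW//.
  by rewrite -mulNr !opprK.
- by move=> x; apply: le_trans (up x) _; exact: straighten_le.
- apply/le_anti/andP; split.
    by apply: le_trans (up z) _; exact: straighten_le.
  by have := straighten_opp z sp; have := up (- z); rewrite uN; lra.
Qed.

End Sublinear.

(** * Annihilators of proper closed subspaces *)

Lemma dominated_dual {R : realType} (E : normedModType R) (u : E -> R^o) :
  linear u -> (forall x, u x <= `|x|) -> exists f : dual E, f = u :> (E -> R^o).
Proof.
move=> lu ule.
pose e : {linear E -> R^o} :=
  HB.pack u (GRing.isLinear.Build R E R^o *:%R u lu).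
have uN x : u (- x) = - u x := linearN e x.
suff cu : u \in @lin_cont R E by exists (Dual cu).
apply/lin_contP; split=> //.
apply: (@bounded_linear_continuous R E R^o e).
apply/bounded_funP => r; exists r => x xr; rewrite ler_norml.
apply/andP; split; last exact: le_trans (ule x) xr.
by rewrite lerNl -uN; apply: le_trans (ule _) _; rewrite normrN.
Qed.

(** Hahn-Banach applied to the distance to [F] at a point outside [F]: this
distance vanishes on [F] and is bounded by the norm. *)
Lemma annihilator_neq0 {R : realType} (E : normedModType R) (F : set E) :
    closed F -> GRing.submod_closed [in F] -> F != setT ->
  exists2 u : dual E, u != 0 & forall y, F y -> u y = 0.
Proof.
move=> clF [/set_mem F0 linF] FT.
have FD a x y : F x -> F y -> F (a *: x + y).
  by move=> Fx Fy; apply/set_mem/linF; exact/mem_set.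
have [z nFz] : exists z, ~ F z.
  apply: contra_notP (negP FT) => /forallNP Fz.
  by apply/eqP/seteqP; split=> // x _; exact: contrapT (Fz x).
pose p (x : E) : R := inf [set `|x - y| | y in F].
have lbp x : has_lbound [set `|x - y| | y in F].
  by exists 0 => _ [y _ <-].
have ple x y : F y -> p x <= `|x - y|.
  by move=> Fy; apply: ge_inf => //; exists y.
have sp : sublinear p.
  apply: sublinear_inf => //; first by exists 0.
    move=> y1 y2 Fy1 Fy2 x1 x2; exists (y1 + y2).
      by rewrite -[y1]scale1r; exact: FD.
    by rewrite opprD addrACA ler_normD.
  move=> y t Fy t0 x; exists (t *: y).
    by rewrite -[t *: y]addr0; exact: FD.
  by rewrite -scalerBr normrZ ger0_norm.
have pz : 0 < p z.
  have : open (~` F) by rewrite openC.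
  rewrite openE => /(_ z nFz); rewrite /interior /= => /nbhs_ballP[e /= e0 be].
  apply: lt_le_trans e0 _; apply: lb_le_inf; first by exists `|z - 0|, 0.
  move=> _ [y Fy <-]; rewrite leNgt; apply/negP => zy.
  by apply: (be y) => //; rewrite -ball_normE.
have [u [lu up uz]] := hahn_banach z sp.
have [|f fu] := @dominated_dual R E u lu.
  move=> x; apply: le_trans (up x) _.
  by rewrite -[in leRHS](subr0 x); exact: ple.
exists f.
  by apply/eqP => f0; move: pz; rewrite -uz -fu f0 ltxx.
have fle y : F y -> f y <= 0.
  move=> Fy; rewrite fu; apply: le_trans (up y) _.
  by rewrite -(normr0 E) -(subrr y) ple.
move=> y Fy; apply/le_anti; rewrite fle//= -oppr_le0 -linearN fle//.
by rewrite -[- y]addr0 -scaleN1r; exact: FD.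
Qed.

(** * Evaluation of functionals *)

Section DualEvaluation.
Context {R : realType} {E : normedModType R}.
Implicit Types (f g : dual E) (x : E).

Lemma dual_oppE f x : (- f) x = - f x.
Proof. by []. Qed.

Lemma dual_subE f g x : (f - g) x = f x - g x.
Proof. by []. Qed.

Lemma dual_ball_le f x : unit_ball E x -> `|f x| <= `|f|.
Proof.
move=> x1; apply: (le_trans (ler_dual_norm f x)).
by rewrite -[leRHS]/(dual_norm f) ler_piMr// dual_norm_ge0.
Qed.

End DualEvaluation.

(** * Lagrange multipliers for affine constraints *)

Section Multipliers.
Context {R : realType} {V : lmodType R}.
Implicit Types (K : set V) (phi psi : V -> R) (f g h : V).

Lemma convex_setP K : convex_set K <->
  forall t g h, 0 <= t <= 1 -> K g -> K h -> K (t *: g + (1 - t) *: h).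
Proof.
split=> [cK t g h /andP[t0 t1] Kg Kh|cK g h t /set_mem Kg /set_mem Kh].
  exact/set_mem/(cK g h (Itv01 t0 t1) (mem_set Kg) (mem_set Kh)).
by apply/mem_set/cK => //; rewrite ge0 le1.
Qed.

Definition affine phi : Prop :=
  forall t g h, phi (t *: g + (1 - t) *: h) = t * phi g + (1 - t) * phi h.

(** One constraint [psi] with a Slater point [f]. The multiplier must lie above
the ratios phi / psi where psi > 0 and below those where psi < 0. The two
families are ordered because a segment from one region to the other meets the
hyperplane psi = 0, where phi <= 0. *)
Lemma multiplier K phi psi f :
    convex_set K -> affine phi -> affine psi -> K f -> psi f < 0 ->
    (forall g, K g -> psi g < 0 -> phi g <= 0) ->
  exists2 l, 0 <= l & forall g, K g -> phi g <= l * psi g.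
Proof.
move=> cK aphi apsi Kf f_lt0 phi_le0.
(* Points with psi = 0 are limits of points of the segment towards f. *)
have phi_le0' g : K g -> psi g <= 0 -> phi g <= 0.
  move=> Kg pg; rewrite leNgt; apply/negP => g_gt0.
  have pf := phi_le0 f Kf f_lt0.
  have d_gt0 : 0 < phi g - phi f by lra.
  (* At this t the convex combination t f + (1 - t) g has phi = phi g / 2. *)
  pose t := phi g / (2 * (phi g - phi f)).
  have tE : t * (phi g - phi f) = phi g / 2.
    by rewrite /t; field; rewrite gt_eqF.
  have t_gt0 : 0 < t by rewrite divr_gt0// mulr_gt0.
  have t_le1 : t <= 1 by rewrite ler_pdivrMr ?mulr_gt0//; lra.
  have := phi_le0 (t *: f + (1 - t) *: g).
  rewrite aphi apsi => /(_ _ _)/wrap[].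
  - by apply: (convex_setP K).1 => //; rewrite ?(ltW t_gt0).
  - have : t * psi f < 0 by rewrite nmulr_llt0.
    have : (1 - t) * psi g <= 0 by rewrite mulr_ge0_le0// subr_ge0.
    by lra.
  - by lra.
have cross g h : K g -> K h -> 0 < psi g -> psi h < 0 ->
    phi g / psi g <= phi h / psi h.
  move=> Kg Kh pg ph; have d_gt0 : 0 < psi g - psi h by lra.
  (* The point where the segment from h to g crosses psi = 0. *)
  pose t := - psi h / (psi g - psi h).
  have tE : t * (psi g - psi h) = - psi h.
    by rewrite /t divfK// gt_eqF.
  have t01 : 0 <= t <= 1.
    by rewrite /t ler_pdivlMr// mul0r ler_pdivrMr// mul1r; lra.
  have := phi_le0' (t *: g + (1 - t) *: h) ((convex_setP K).1 cK _ _ _ t01 Kg Kh).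
  have -> : psi (t *: g + (1 - t) *: h) = 0 by rewrite apsi; lra.
  rewrite aphi => /(_ (lexx _)).
  rewrite -(ler_pM2r d_gt0) mul0r => le0.
  rewrite ler_pdivrMr// mulrAC ler_ndivlMr//; move: le0.
  have -> : (t * phi g + (1 - t) * phi h) * (psi g - psi h) =
      (t * (psi g - psi h)) * phi g +
      (psi g - psi h - t * (psi g - psi h)) * phi h by ring.
  by rewrite tE; lra.
(* Including 0 keeps the multiplier nonnegative and the set nonempty. *)
pose L := [set l | l = 0 \/ exists2 g, K g /\ 0 < psi g & l = phi g / psi g].
have ubL h : K h -> psi h < 0 -> ubound L (phi h / psi h).
  move=> Kh ph _ [->|[g [Kg pg] ->]]; last exact: cross.
  by rewrite ler_ndivlMr// mul0r phi_le0.
have hsL : has_sup L.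
  by split; [exists 0; left|exists (phi f / psi f); exact: ubL].
exists (sup L); first by apply: ub_le_sup; [exact: hsL.2|left].
move=> g Kg; have [pg|pg|pg] := ltgtP (psi g) 0.
- by rewrite -ler_ndivlMr//; apply: ge_sup; [exact: hsL.1|exact: ubL].
- rewrite -ler_pdivrMr//; apply: ub_le_sup; first exact: hsL.2.
  by right; exists g.
- by rewrite pg mulr0 phi_le0'// pg.
Qed.

End Multipliers.

(** * Balls given by w*-weak points of continuity *)

Lemma dual_norm_le_ball {R : realType} {E : normedModType R}
    (h : dual E) (c : R) :
  (forall x, unit_ball E x -> h x <= c) -> `|h| <= c.
Proof.
move=> hc; apply: ge_sup; first by have [] := dual_norm_has_sup h.
move=> _ [x x1 <-]; rewrite ler_norml hc// andbT lerNl -linearN hc//.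
by rewrite /unit_ball/= normrN.
Qed.

Section WeakStarWeakPC.
Context {R : realType} {X : normedModType R}.
Implicit Types (f g : dual X) (u v : dual (dual X)) (x y : X).

Lemma affine_sub_eval u (c : R) : affine (fun g : dual X => u g - c).
Proof. by move=> t g h; rewrite linearD !linearZ /= /GRing.scale/=; lra. Qed.

(** Induction on the number of constraints: the last one is first absorbed into
the convex set [K], and then removed from it by [multiplier]. As the
constraints are evaluations at points of X, the multipliers assemble into a
single point of X. *)
Lemma linear_multiplier (s : seq X) (K : set (dual X)) (phi : dual X -> R) f :
    convex_set K -> affine phi -> K f ->
    (forall g, K g -> (forall x, x \in s -> g x < f x + 1) -> phi g <= 0) ->
  exists y, forall g, K g -> phi g <= g y - f y.
Proof.
elim: s K => [|x s IH] K cK aphi Kf phi_le0.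
  exists 0 => g Kg; rewrite (linear0 g) (linear0 f) subrr; exact: phi_le0.
pose psi g : R := g x - (f x + 1).
have apsi : affine psi := affine_sub_eval (canonical_image x) (f x + 1).
have [|||y phi_y] := IH (K `&` [set g | psi g < 0]) _ aphi.
- apply/convex_setP => t g h t01 [Kg pg] [Kh ph]; split.
    exact: (convex_setP K).1.
  by rewrite /= apsi; move: t01 pg ph => /andP[] /=; nra.
- by split=> //; rewrite /= /psi; lra.
- move=> g [Kg pg] gs; apply: phi_le0 => // z; rewrite inE => /predU1P[->|].
    by move: pg; rewrite /= /psi; lra.
  exact: gs.
have ay : affine (fun g => g y - f y) := affine_sub_eval (canonical_image y) _.
have aphi' : affine (fun g => phi g - (g y - f y)).
  by move=> t g h; rewrite aphi ay; lra.
have [|g Kg pg|l l0 phi_l] := multiplier cK aphi' apsi Kf.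
- by rewrite /psi; lra.
- by rewrite subr_le0; exact: phi_y.
exists (y + l *: x) => g Kg; rewrite !linearD !linearZ /= /GRing.scale/=.
by have := phi_l g Kg; rewrite /psi; nra.
Qed.

(** Only constraints g(x) < f(x) + 1 are needed: |g(x) - f(x)| < e follows from
those at x / e and - x / e. These constraint sets form a filter base that
converges pointwise to [f], hence is finer than the w*-neighbourhoods. *)
Lemma weak_star_nbhs f (W : set (dual X)) : nbhs (f : weak_star X) W ->
  exists s : seq X, forall g, (forall x, x \in s -> g x < f x + 1) -> W g.
Proof.
pose G : set_system (dual X) := filter_from [set: seq X]
  (fun s => [set g : dual X | forall x, x \in s -> g x < f x + 1]).
have FG : Filter G.
  apply: filter_from_filter; first by exists [::].
  move=> s t _ _; exists (s ++ t) => // g gst; split=> x xs; apply: gst.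
    by rewrite mem_cat xs.
  by rewrite mem_cat xs orbT.
have Gx x (e : R) : 0 < e -> G [set g | `|f x - g x| < e].
  move=> e0; exists [:: e^-1 *: x; - (e^-1 *: x)] => // g gs /=.
  have := gs (e^-1 *: x); have := gs (- (e^-1 *: x)).
  rewrite !inE !eqxx orbT => /(_ isT) + /(_ isT).
  rewrite !linearN !linearZ /= /GRing.scale/= => g1 g2.
  rewrite ltr_distlC.
  have e1 : e * e^-1 = 1 by rewrite divff// gt_eqF.
  have h1 : e * (e^-1 * g x) < e * (e^-1 * f x + 1) by rewrite ltr_pM2l.
  have h2 : e * (e^-1 * - g x) < e * (e^-1 * - f x + 1) by rewrite ltr_pM2l.
  move: h1 h2; rewrite !mulrDr !mulrN !mulrA e1 !mul1r mulr1 => h1 h2.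
  by apply/andP; split; lra.
have Gf : {ptws, (fun g : dual X => (g : X -> R^o)) @ G --> (f : X -> R^o)}.
  apply/pointwise_cvgP => x; apply/cvgrPdist_lt => e e0; exact: Gx.
move=> [_ [[B oB <-] fB] BW].
have [s _ sB] : G [set g | B g].
  by apply: Gf; exact: open_nbhs_nbhs.
by exists s => g gs; apply: BW; exact: sB.
Qed.

(** The unit ball of the dual is the convex set to which the multipliers apply;
the inequality they give on it is a bound on the norm of u - y. *)
Lemma wstar_weak_PC_ball_approx f u (d : R) : wstar_weak_PC f -> 0 < d ->
  exists x, f x + `|canonical_image x - u| <= u f + d.
Proof.
move=> [f1 cf] d0.
have Wf : nbhs (f : weak (dual X)) [set g | u g < u f + d].
  have cu : {for (f : weak (dual X)), continuous (fun g : weak (dual X) => u g)}.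
    pose ev (g : dual X) : {ptws dual (dual X) -> R^o} := fun v => v g.
    apply: (@continuous_comp _ _ _ (ev : weak (dual X) -> _) (@^~ u)).
      exact: (@initial_continuous _ _ ev).
    exact: (@proj_continuous _ (fun=> R^o) u).
  by apply: (cu [set a | a < u f + d]); apply: lt_nbhsl; rewrite ltrDl.
have [s sW] : exists s : seq X, forall g, (forall x, x \in s -> g x < f x + 1) ->
    unit_ball (dual X) g -> u g < u f + d.
  apply: weak_star_nbhs.
  (* Neighbourhoods in the ball are traces of neighbourhoods, for both
     topologies. *)
  pose A := unit_ball (dual X); pose U := [set g : dual X | u g < u f + d].
  have subP (T : topologicalType) (B : set T) (t : T) (V : set T) :
      B t -> within B (nbhs t) V = nbhs (t : subspace B) V.
    by move=> Bt; rewrite nbhs_subspace_in.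
  have [cf' Wf'] := (subP (weak_star X) A f U f1, subP (weak (dual X)) A f U f1).
  suff : within A (nbhs (f : weak_star X)) U by [].
  by rewrite cf'; apply: (cf U); rewrite -Wf'; apply: filterS Wf => g ug _.
have ball0 : convex_set (unit_ball (dual X)).
  apply/convex_setP => t g h /andP[t0 t1] g1 h1; apply: le_trans (ler_normD _ _) _.
  rewrite !normrZ (ger0_norm t0) ger0_norm ?subr_ge0//.
  by move: g1 h1; rewrite /unit_ball/=; nra.
have [g g1 gs|y yP] :=
    linear_multiplier (s := s) ball0 (affine_sub_eval u (u f + d)) f1.
  by rewrite subr_le0 ltW// sW.
exists y; rewrite -lerBrDl distrC; apply: dual_norm_le_ball => g g1.
have ug : (u g : R) - (u f + d) <= (g y : R) - f y := yP g g1.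
suff : (u g : R) - g y <= u f + d - f y by [].
by lra.
Qed.

End WeakStarWeakPC.

(** * Closed linear spans *)

Lemma canonical_image_norm {R : realType} (E : normedModType R) (x : E) :
  `|canonical_image x| <= `|x|.
Proof.
apply: dual_norm_le => // f; rewrite mulrC; exact: (ler_dual_norm f x).
Qed.

Lemma canonical_imageN {R : realType} (E : normedModType R) (x : E) :
  canonical_image (- x) = - canonical_image x.
Proof.
by apply/val_inj/funext => f; rewrite [LHS](linearN f).
Qed.

Section ClosedLinearSpan.
Context {R : realType} {E : normedModType R}.
Implicit Types (A F : set E) (x y : E).

Lemma submod_closedP F : GRing.submod_closed [in F] <->
  F 0 /\ forall (a : R) x y, F x -> F y -> F (a *: x + y).
Proof.
split=> [[/set_mem F0 linF]|[F0 linF]]; split=> //.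
- by move=> a x y Fx Fy; apply/set_mem/linF; exact/mem_set.
- exact/mem_set.
- by move=> a x y /set_mem Fx /set_mem Fy; apply/mem_set/linF.
Qed.

Lemma closure_submod_closed F :
  GRing.submod_closed [in F] -> GRing.submod_closed [in closure F].
Proof.
move=> /submod_closedP[F0 linF]; apply/submod_closedP; split.
  exact: subset_closure.
move=> a x y clx cly B; rewrite -nbhs_ballE => -[e /= e0 Be].
have a0 : 0 < `|a| + 1 by rewrite ltr_wpDl.
have ea0 : 0 < e / 2 / (`|a| + 1) by rewrite !divr_gt0.
have e20 : 0 < e / 2 by rewrite divr_gt0.
have [x' [Fx' xx']] := clx _ (nbhsx_ballx x _ ea0).
have [y' [Fy' yy']] := cly _ (nbhsx_ballx y _ e20).
exists (a *: x' + y'); split; first exact: linF.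
apply: Be; move: xx' yy'; rewrite -!ball_normE /= => xx' yy'.
rewrite opprD addrACA -scalerBr.
apply: le_lt_trans (ler_normD _ _) _; rewrite normrZ.
rewrite ltr_pdivlMr// mulrC in xx'.
have : `|a| * `|x - x'| <= (`|a| + 1) * `|x - x'| by rewrite ler_wpM2r// lerDl.
by lra.
Qed.

Lemma closed_linear_span_submod A :
  GRing.submod_closed [in closed_linear_span A].
Proof.
apply/closure_submod_closed/submod_closedP; split.
  by move=> F [/submod_closedP[F0 _] _].
move=> a x y Ax Ay F [sF AF]; have /submod_closedP[_ linF] := sF.
by apply: linF; [exact: Ax|exact: Ay].
Qed.

Lemma closed_linear_span_sub A F : closed F -> GRing.submod_closed [in F] ->
  A `<=` F -> closed_linear_span A `<=` F.
Proof.
move=> clF sF AF; rewrite [X in _ `<=` X](closure_id F).1//.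
by apply: closure_subset; apply: smallest_sub.
Qed.

Lemma sub_closed_linear_span A : A `<=` closed_linear_span A.
Proof. by move=> x Ax; apply: subset_closure; exact: sub_gen_smallest. Qed.

Lemma total_separates A (u v : dual E) : closed_linear_span A = setT ->
  (forall x, A x -> u x = v x) -> u = v.
Proof.
move=> AT uv; apply/eqP; rewrite -subr_eq0; apply/eqP.
have : forall x, A x -> (u - v) x = 0.
  by move=> x Ax; rewrite dual_subE uv// subrr.
move: (u - v) => w wA; pose F := [set x | w x = 0].
have FT : closed_linear_span A `<=` F.
  apply: closed_linear_span_sub.
  - have -> : F = w @^-1` [set 0] by [].
    apply: (continuous_closedP _).1; first exact: dual_continuous.
    exact: closed_eq.
  - apply/submod_closedP; split=> [|a x y Fx Fy]; first exact: linear0.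
    by rewrite /F /= linearD linearZ /= Fx Fy scaler0 addr0.
  - exact: wA.
apply/val_inj/funext => x.
by have := FT x; rewrite AT; exact.
Qed.

End ClosedLinearSpan.

(** * Separation by balls and nice smoothness *)

Section NicelySmoothSpaces.
Context {R : realType} {X : normedModType R}.
Implicit Types (f g : dual X) (u v : dual (dual X)) (x y : X).

Definition balls_separate u v : Prop :=
  exists (x y : X) (r s : R), [/\ 0 < r, 0 < s,
    closed_ball (canonical_image x) r u,
    closed_ball (canonical_image y) s v &
    closed_ball (canonical_image x) r `&` closed_ball (canonical_image y) s
      = set0].

Lemma wstar_weak_PC_ball_below f u (c : R) : wstar_weak_PC f -> u f < c ->
  exists x r, [/\ 0 < r, closed_ball (canonical_image x) r u &
    forall w, closed_ball (canonical_image x) r w -> w f < c].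
Proof.
move=> PCf ufc; pose d := (c - u f) / 3.
have d0 : 0 < d by rewrite divr_gt0// subr_gt0.
have [x xP] := wstar_weak_PC_ball_approx u PCf d0.
have r0 : 0 < `|canonical_image x - u| + d by rewrite ltr_wpDl.
exists x, (`|canonical_image x - u| + d); rewrite closed_ballE//; split=> //.
  by rewrite /closed_ball_ /= lerDl ltW.
move=> w; rewrite /closed_ball_/= => wr.
have : `|(w - canonical_image x) f| <= `|canonical_image x - w|.
  by rewrite [leRHS]distrC; apply: dual_ball_le; exact: PCf.1.
rewrite dual_subE => /(le_trans (ler_norm _)) wf.
suff : (w f : R) < c by [].
have wf' : (w f : R) - f x <= `|canonical_image x - w| := wf.
have xP' : (f x : R) + `|canonical_image x - u| <= u f + d := xP.
have dE : d * 3 = c - u f by rewrite /d divfK.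
by lra.
Qed.

(** Half-spaces above a level are half-spaces below a level for - v, and
negation exchanges the balls of centres y and - y. *)
Lemma wstar_weak_PC_balls_separate f u v : wstar_weak_PC f -> u f < v f ->
  balls_separate u v.
Proof.
move=> PCf uv; pose c : R := ((u f : R) + v f) / 2.
have uc : (u f : R) < c by rewrite /c; move: uv => /=; lra.
have vc : (- v) f < - c.
  by rewrite dual_oppE ltrN2 /c; move: uv => /=; lra.
have [x [r [r0 xu xP]]] := wstar_weak_PC_ball_below PCf uc.
have [y [s [s0 yv yP]]] := wstar_weak_PC_ball_below PCf vc.
have ballN w : closed_ball (canonical_image (- y)) s w =
    closed_ball (canonical_image y) s (- w).
  rewrite !closed_ballE// /closed_ball_ /= canonical_imageN.
  by rewrite -opprD normrN opprK.
exists x, (- y), r, s; split=> //; first by rewrite ballN.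
apply/seteqP; split=> // w [/xP wc]; rewrite ballN => /yP.
by rewrite dual_oppE ltrN2 => /(lt_trans wc); rewrite ltxx.
Qed.

Lemma total_PC_balls_separate :
  closed_linear_span [set f : dual X | wstar_weak_PC f] = [set: dual X] ->
  forall u v, u <> v -> balls_separate u v.
Proof.
move=> spanT u v uv.
have [f PCf] : exists2 f, wstar_weak_PC f & u f != v f.
  apply: contra_notP uv => nuv; apply: (total_separates spanT) => f PCf.
  by apply/eqP/negPn/negP => uvf; apply: nuv; exists f.
have [uvf|vuf|//] := ltgtP (u f : R) (v f).
  by move=> _; exact: wstar_weak_PC_balls_separate uvf.
move=> _; have [x [y [r [s [r0 s0 xv yu xy0]]]]] :=
  wstar_weak_PC_balls_separate PCf vuf.
by exists y, x, s, r; rewrite setIC.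
Qed.

(** On [F] the functional x - u takes the values of x, and these already give
the norm of x. *)
Lemma norming_annihilator_le (F : set (dual X)) u x : norming_subspace F ->
  (forall f, F f -> u f = 0) -> `|x| <= `|canonical_image x - u|.
Proof.
move=> [_ _ [_ normF]] uF; rewrite -lee_fin normF.
apply: ge_ereal_sup => _ [f [Ff f1] <-]; rewrite lee_fin.
have -> : f x = (canonical_image x - u) f.
  by rewrite dual_subE uF// subr0.
exact: le_trans (ler_norm _) (dual_ball_le _ f1).
Qed.

(** If [u] annihilates a norming subspace, every ball centred in X which contains
[u] contains 0. *)
Lemma balls_separate_nicely_smooth :
  (forall u v, u <> v -> balls_separate u v) -> nicely_smooth X.
Proof.
move=> sep F nF; apply: contrapT => /eqP FT.
have [clF sF _] := nF.
have [u u0 uF] := annihilator_neq0 clF sF FT.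
have [x [y [r [s [r0 s0 xu y0 xy0]]]]] := sep u 0 (elimN eqP u0).
have : set0 (0 : dual (dual X)); last by [].
rewrite -xy0; split=> //; move: xu; rewrite !closed_ballE// /closed_ball_ /=.
rewrite subr0; apply: le_trans.
exact: le_trans (canonical_image_norm x) (norming_annihilator_le x nF uF).
Qed.

Lemma support_mapping_norming (A : set X) (phi : X -> dual X) :
    A `<=` unit_sphere X -> unit_sphere X `<=` closure A ->
    support_mapping phi ->
  norming_subspace (closed_linear_span (phi @` A)).
Proof.
move=> A1 Adense phiP; set F := closed_linear_span _.
have sF : GRing.submod_closed [in F] := closed_linear_span_submod _.
split=> //; first exact: closed_closure.
split=> [f []//|x].
apply/le_anti/andP; split; last first.
  apply: ge_ereal_sup => _ [f [_ f1] <-]; rewrite lee_fin.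
  apply: le_trans (ler_norm _) (le_trans (ler_dual_norm f x) _).
  by rewrite ler_piMl.
have [->|x0] := eqVneq x 0.
  apply: ereal_sup_ubound; exists 0; last by rewrite linear0 normr0.
  split; first exact: ((submod_closedP F).1 sF).1.
  by rewrite /unit_ball /= normr0.
have nx : 0 < `|x| by rewrite normr_gt0.
(* a is within e / |x| of x / |x|, so that phi a x is within e of |x|. *)
apply/lee_addgt0Pr => e e0.
pose z := `|x|^-1 *: x.
have z1 : unit_sphere X z by rewrite /unit_sphere /= normfZV.
have ex0 : 0 < e / `|x| by rewrite divr_gt0.
have [a [Aa]] := Adense z z1 _ (nbhsx_ballx z _ ex0).
rewrite -ball_normE /= => za.
have [phia1 phiaa] := phiP a (A1 a Aa).
have phiax : `|x| - e <= phi a x.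
  have xE : (phi a x : R) = `|x| * phi a z.
    by rewrite linearZ /= /GRing.scale/= mulrA divff ?gt_eqF// mul1r.
  have : `|phi a (z - a)| <= e / `|x|.
    apply: le_trans (ler_dual_norm _ _) _.
    by rewrite [dual_norm _]phia1 mul1r ltW.
  rewrite ler_norml => /andP[+ _].
  rewrite linearB /= phiaa lerNl ler_pdivlMr// /GRing.scale/= => h.
  have h' : (- ((phi a z : R) - 1)) * `|x| <= e := h.
  by rewrite xE; lra.
apply: (@le_trans _ _ ((phi a x : R)%:E + e%:E)%E).
  by rewrite -EFinD lee_fin -lerBlDr.
apply: leeD => //; apply: ereal_sup_ubound; exists (phi a) => //; split.
  by apply: sub_closed_linear_span; exists a.
by rewrite /unit_ball /= phia1.
Qed.

Lemma nicely_smooth_separates (A : set X) (phi : X -> dual X) :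
    nicely_smooth X -> A `<=` unit_sphere X -> unit_sphere X `<=` closure A ->
    support_mapping phi -> separates_bidual (phi @` A).
Proof.
move=> nsX A1 Adense phiP u v uv.
have spanT := nsX _ (support_mapping_norming A1 Adense phiP).
apply: contra_notP uv => nuv; apply: (total_separates spanT) => f Af.
by apply: contrapT => uvf; apply: nuv; exists f.
Qed.

End NicelySmoothSpaces.

Theorem proposition2 (R : realType) (X : completeNormedModType R) :
  let a := closed_linear_span [set f : dual X | wstar_weak_PC f]
           = [set: dual X] in
  let b := forall u v : dual (dual X), u <> v ->
    exists (x y : X) (r s : R), [/\ 0 < r, 0 < s,
      closed_ball (canonical_image x) r u,
      closed_ball (canonical_image y) s v &
      closed_ball (canonical_image x) r `&` closed_ball (canonical_image y) s
        = set0] in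
  let c := nicely_smooth X in
  let d := forall (A : set X) (phi : X -> dual X),
    A `<=` unit_sphere X -> unit_sphere X `<=` closure A ->
    support_mapping phi -> separates_bidual (phi @` A) in
  (a -> b) /\ (b -> c) /\ (c -> d).
Proof.
move=> a b c d; split; first exact: total_PC_balls_separate.
split; first exact: balls_separate_nicely_smooth.
by move=> nsX A phi; exact: nicely_smooth_separates.
Qed.
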